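(* Let $L$ be a Dirac structure on the foliated manifold $(M,\mathcal{F})$. Assume that $L$ has a presymplectic leaf $S$ such that $T_SM=TS\oplus F|_S$, where $F=T\mathcal{F}$ and $T_SM=TM|_S$. Then there exists an open neighborhood $U$ of $S$ in $M$ such that $L|_U$ is coupling with respect to the foliation $\mathcal{F}\cap U$ (the restriction of $\mathcal{F}$ to $U$).
   Context: All objects are $C^\infty$; $\mathcal{F}$ is a regular foliation of the $n$-dimensional manifold $M$, $F=T\mathcal{F}$, and $ann\,F\subseteq T^*M$ is the annihilator of $F$. On $TM\oplus T^*M$ consider the pairing $g((X,\alpha),(Y,\beta))=\frac12(\beta(X)+\alpha(Y))$ and the Courant bracket $[(X,\alpha),(Y,\beta)]=([X,Y],\,L_X\beta-L_Y\alpha+\frac12 d(\alpha(Y)-\beta(X)))$. An almost Dirac structure on $M$ is a maximal $g$-isotropic (rank $n$) subbundle $L\subseteq TM\oplus T^*M$; it is a Dirac structure if $\Gamma L$ is closed under the Courant bracket. For a Dirac structure $L$, $L_+=pr_{TM}(L)$ is an integrable generalized distribution; its leaves (integral submanifolds $S$, so that $T_xS=L_{+,x}$ for all $x\in S$) are called the presymplectic leaves of $L$. For an almost Dirac structure $L$ put $H_x(L,\mathcal{F})=\{Z\in T_xM\,:\,\exists\,\alpha\in ann\,F_x\text{ with }(Z,\alpha)\in L_x\}$. $L$ is $\mathcal{F}$-coupling (coupling with respect to $\mathcal{F}$) if $T_xM=H_x(L,\mathcal{F})\oplus F_x$ at every point $x$. *)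

(* Defs.v *)
From HB Require Import structures.
From mathcomp Require Import all_boot all_order all_algebra.
From mathcomp Require Import all_classical all_reals all_analysis.
Import Order.TTheory GRing.Theory Num.Theory.
Import numFieldNormedType.Exports.

Set Implicit Arguments.
Unset Strict Implicit.
Unset Printing Implicit Defensive.

Local Open Scope classical_set_scope.
Local Open Scope ring_scope.

Section Smooth.
Context {R : realType}.

(* f is C^k iff it is differentiable and its partial derivatives are C^(k-1);
   meant for an open set O. *)
Fixpoint Ck (k : nat) (n : nat) (V : normedModType R) (O : set 'rV[R]_n)
    (f : 'rV[R]_n -> V) : Prop :=
  match k with
  | 0 => forall z, O z -> {for z, continuous f}
  | k'.+1 => (forall z, O z -> differentiable f z) /\
             forall i : 'I_n, Ck k' O (fun z => 'D_(delta_mx 0 i) f z)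
  end.

Definition smooth_on (n : nat) (V : normedModType R) (O : set 'rV[R]_n)
  (f : 'rV[R]_n -> V) : Prop := forall k, Ck k O f.

Lemma Ck_sub k n (V : normedModType R) (O O' : set 'rV[R]_n)
  (f : 'rV[R]_n -> V) : O' `<=` O -> Ck k O f -> Ck k O' f.
Proof.
move=> sO; elim: k f => [|k IH] f /=; first by move=> h z /sO/h.
by move=> [h1 h2]; split=> [z /sO/h1|i] //; apply/IH/h2.
Qed.

Lemma near_eq_differentiable (V W : normedModType R) (f g : V -> W) (a : V) :
  {near a, f =1 g} -> differentiable f a -> differentiable g a.
Proof.
move=> fg df; have [dc /= de] := (diff_locallyP a f).1 df.
have gE : g \o shift a = cst (g a) + 'd f a +o_ 0 id.
  rewrite -(nbhs_singleton fg); apply/eqaddoP => _/posnumP[e].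
  have /eqaddoP /(_ _ [elaborate gt0 e]) fe := de.
  have fg0 : \forall h \near (0 : V), f (h + a) = g (h + a).
    have := fg; rewrite (near_shift 0) subr0 => h; near=> u.
    by have := near h u; apply.
  move: fe; apply: filter_app; move: fg0; apply: filterS => h /= fgh.
  by rewrite !fctE /= fgh.
by apply/diff_locallyP; rewrite (diff_unique dc gE).
Unshelve. all: by end_near. Qed.

Lemma Ck_eq k n (V : normedModType R) (O : set 'rV[R]_n)
  (f g : 'rV[R]_n -> V) :
  open O -> (forall z, O z -> f z = g z) -> Ck k O f -> Ck k O g.
Proof.
move=> oO; elim: k f g => [|k IH] f g fg /=.
  move=> cf z Oz; have nfg : {near z, f =1 g}.
    by apply: filterS (open_nbhs_nbhs (conj oO Oz)) => y /fg.
  rewrite /prop_for /continuous_at -(fg z Oz).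
  exact: cvg_trans (near_eq_cvg nfg) (cf z Oz).
have nfg z : O z -> {near z, f =1 g}.
  by move=> Oz; apply: filterS (open_nbhs_nbhs (conj oO Oz)) => y /fg.
move=> [df pf]; split=> [z Oz|i].
  exact: near_eq_differentiable (nfg z Oz) (df z Oz).
by apply: IH (pf i) => z Oz; apply/near_eq_derive/nfg.
Qed.

End Smooth.

Section Charts.
Context {R : realType} {n : nat}.

(* The values of [coord] outside [dom] are irrelevant. *)
Record chart (M : Type) :=
  Chart { dom : set M ; coord :> M -> 'rV[R]_n }.

Record is_chart (M : topologicalType) (c : chart M) : Prop := IsChart {
  chart_dom_open : open (dom c) ;
  chart_inj : forall x y, dom c x -> dom c y -> c x = c y -> x = y ;
  chart_continuous : forall x, dom c x -> {for x, continuous c} ;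
  chart_open_map : forall W, open W -> W `<=` dom c -> open (c @` W) }.

(* f o c^-1 on the image of the chart c, and 0 elsewhere *)
Definition rep (M : Type) (V : normedModType R) (c : chart M) (f : M -> V)
    (z : 'rV[R]_n) : V :=
  xget 0 (f @` [set x | dom c x /\ c x = z]).

Definition compatible (M : Type) (c d : chart M) : Prop :=
  smooth_on (c @` (dom c `&` dom d)) (rep c d) /\
  smooth_on (d @` (dom c `&` dom d)) (rep d c).

Lemma repE (M : topologicalType) (V : normedModType R) (c : chart M)
  (f : M -> V) x : is_chart c -> dom c x -> rep c f (c x) = f x.
Proof.
move=> hc cx; rewrite /rep; case: xgetP => [y -> [z [cz /chart_inj zx] <-]|].
  by rewrite zx.
by move=> /(_ (f x)) []; exists x.
Qed.

(* The matrix of d(d o c^-1) at c x, acting on row vectors *)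
Definition transition (M : Type) (c d : chart M) (x : M) : 'M[R]_n :=
  'J (rep c d) (c x).

Definition restrict_chart (M : Type) (U : set M) (c : chart M) : chart U :=
  Chart (set_val @^-1` dom c) (c \o set_val).

End Charts.
Arguments chart R n M : clear implicits.

(* A smooth manifold is given by a smooth atlas, with a preferred chart of the
   atlas around each point: the elements of T_xM (resp. T*_xM) are represented
   by the row vectors of their components in the frame d/dx^i (resp. the coframe
   dx^i) of [chart_at x]. *)
Record manifold (R : realType) (n : nat) := Manifold {
  carrier :> topologicalType ;
  atlas : set (chart R n carrier) ;
  chart_at : carrier -> chart R n carrier ;
  manifold_hausdorff : hausdorff_space carrier ;
  manifold_second_countable : @second_countable carrier ;
  atlas_chart : forall c, atlas c -> is_chart c ;
  atlas_compatible : forall c d, atlas c -> atlas d -> compatible c d ;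
  atlas_chart_at : forall x, atlas (chart_at x) ;
  dom_chart_at : forall x, dom (chart_at x) x }.

Section OpenSubmanifold.
Context {R : realType} {n : nat}.

Section Restrict.
Context {M : topologicalType} {U : set M}.
Hypothesis oU : open U.

Lemma set_val_continuous : continuous (set_val : U -> M).
Proof. exact: initial_continuous. Qed.

Lemma set_val_inj : injective (set_val : U -> M).
Proof. exact: val_inj. Qed.

Lemma set_val_open (W : set U) : open W -> open (set_val @` W).
Proof.
move=> [V oV <-]; rewrite (_ : _ @` _ = V `&` U); first exact: openI.
apply/seteqP; split=> [_ [u Ou <-]|x [Ox Ux]]; first by split => //; apply: set_valP.
by exists (SigSub (mem_set Ux)).
Qed.

Lemma set_type_hausdorff : hausdorff_space M -> hausdorff_space U.
Proof.
move=> hM x y xy; apply/set_val_inj/hM => A B xA yB.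
have [z [Az Bz]] := xy _ _ (set_val_continuous xA) (set_val_continuous yB).
by exists (set_val z).
Qed.

Lemma set_type_second_countable : @second_countable M -> @second_countable U.
Proof.
move=> [B cB [oB bB]]; exists [set set_val @^-1` b | b in B].
  exact: (sub_countable (card_image_le _ _) cB).
split=> [_ [b /oB ob <-]|x A]; first by exists b.
rewrite /= nbhsE => -[_ [[V oV <-] Vx] VA].
have [b [Bb bx] bV] := bB (set_val x) V (open_nbhs_nbhs (conj oV Vx)).
by exists (set_val @^-1` b); [split=> //; exists b|move=> y /bV/VA].
Qed.

Lemma restrict_is_chart (c : chart R n M) :
  is_chart c -> is_chart (restrict_chart U c).
Proof.
move=> hc; split => /=.
- by exists (dom c) => //; exact: chart_dom_open hc.
- by move=> x y cx cy /(chart_inj hc cx cy)/set_val_inj.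
- move=> x cx; apply: continuous_comp; first exact: set_val_continuous.
  exact: (chart_continuous hc cx).
- move=> W oW Wc; rewrite -[c \o _]/(coord c \o set_val) -image_comp.
  apply: (chart_open_map hc).
    exact: set_val_open.
  by move=> _ [u /Wc ? <-].
Qed.

Lemma restrict_compatible (c d : chart R n M) :
  is_chart c -> is_chart d -> compatible c d ->
  compatible (restrict_chart U c) (restrict_chart U d).
Proof.
have main (e f : chart R n M) (D := dom (restrict_chart U c) `&` dom (restrict_chart U d)) :
    is_chart c -> is_chart d -> is_chart e ->
    D `<=` dom (restrict_chart U e) ->
    smooth_on (e @` (dom c `&` dom d)) (rep e f) ->
    smooth_on (restrict_chart U e @` D)
      (rep (restrict_chart U e) (restrict_chart U f)).
  move=> hc hd he De sm k.
  have hc' := restrict_is_chart hc; have hd' := restrict_is_chart hd.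
  have he' := restrict_is_chart he.
  apply: (@Ck_eq _ _ _ _ _ (rep e f)).
  - apply: (chart_open_map he') => //.
    exact: openI (chart_dom_open hc') (chart_dom_open hd').
  - by move=> _ [u /De Du <-]; rewrite (repE _ he' Du) (repE _ he Du).
  - apply: (Ck_sub _ (sm k)) => _ [u [cu du] <-].
    by exists (set_val u).
by move=> hc hd [h1 h2]; split; apply: main => //; move=> u [].
Qed.

End Restrict.

(* The inclusion U -> M is the identity in the preferred charts, so that T_xU
   and T_xM have the same representation. *)
Program Definition open_submanifold (M : manifold R n) (U : set M)
    (oU : open U) : manifold R n :=
  @Manifold R n U (restrict_chart U @` @atlas R n M)
    (fun x => restrict_chart U (chart_at (set_val x))) _ _ _ _ _ _.
Next Obligation. by move=> M U oU; apply/set_type_hausdorff/manifold_hausdorff. Qed.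
Next Obligation.
by move=> M U oU; apply/set_type_second_countable/manifold_second_countable.
Qed.
Next Obligation.
by move=> M U oU _ [c /atlas_chart hc <-]; apply: restrict_is_chart.
Qed.
Next Obligation.
move=> M U oU _ _ [c hc <-] [d hd <-].
by apply: restrict_compatible => //;
  [exact: atlas_chart|exact: atlas_chart|exact: atlas_compatible].
Qed.
Next Obligation.
by move=> M U oU x; exists (chart_at (set_val x)) => //; apply: atlas_chart_at.
Qed.
Next Obligation. by move=> M U oU x; apply: dom_chart_at. Qed.

End OpenSubmanifold.

Section Foliations.
Context {R : realType} {n : nat}.

Definition same_transverse (p : nat) (z z' : 'rV[R]_n) : Prop :=
  forall i : 'I_n, (p <= i)%N -> z 0 i = z' 0 i.

(* A regular foliation of dimension p, given by an atlas of foliated charts: the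
   plaques are the level sets of the last n - p coordinates, and the coordinate
   changes locally map plaques into plaques. *)
Record foliation (M : manifold R n) := Foliation {
  leaf_dim : nat ;
  fol_atlas : set (chart R n M) ;
  leaf_dim_le : (leaf_dim <= n)%N ;
  fol_atlas_chart : forall c, fol_atlas c -> is_chart c ;
  fol_atlas_compatible : forall c d,
    fol_atlas c -> atlas d -> compatible c d ;
  fol_atlas_cover : forall x, exists2 c, fol_atlas c & dom c x ;
  fol_atlas_plaques : forall c d x,
    fol_atlas c -> fol_atlas d -> dom c x -> dom d x ->
    exists W, [/\ open W, W x, W `<=` dom c `&` dom d &
      forall y y', W y -> W y' -> same_transverse leaf_dim (c y) (c y') ->
        same_transverse leaf_dim (d y) (d y')] }.

(* T_xF : the vectors tangent to the plaque through x *)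
Definition fol_tangent (M : manifold R n) (F : foliation M) (x : M) :
    set 'rV[R]_n :=
  [set v | exists c, [/\ fol_atlas F c, dom c x &
     same_transverse (leaf_dim F) (v *m transition (chart_at x) c x) 0]].

Program Definition restrict_foliation (M : manifold R n) (U : set M)
    (oU : open U) (F : foliation M) : foliation (open_submanifold oU) :=
  @Foliation (open_submanifold oU) (leaf_dim F)
    (restrict_chart U @` fol_atlas F) (leaf_dim_le F) _ _ _ _.
Next Obligation.
by move=> M U oU F _ [c /fol_atlas_chart hc <-]; apply: restrict_is_chart.
Qed.
Next Obligation.
move=> M U oU F _ _ [c hc <-] [d hd <-].
by apply: restrict_compatible => //;
  [exact: fol_atlas_chart hc|exact: atlas_chart|exact: fol_atlas_compatible hc hd].
Qed.
Next Obligation.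
move=> M U oU F x; have [c hc cx] := fol_atlas_cover F (set_val x).
by exists (restrict_chart U c) => //; exists c.
Qed.
Next Obligation.
move=> M U oU F _ _ x [c hc <-] [d hd <-] cx dx.
have [W [oW Wx Wcd Wp]] := fol_atlas_plaques hc hd cx dx.
exists (set_val @^-1` W); split => //; first by exists W.
- by move=> y /Wcd.
- by move=> y y'; apply: Wp.
Qed.

End Foliations.

Section TensorCalculus.
Context {R : realType} {n : nat}.
Variable M : manifold R n.

Local Notation TTM := ('rV[R]_n * 'rV[R]_n)%type.

(* a(v) for a in T*_xM and v in T_xM *)
Definition pairing (a v : 'rV[R]_n) : R := (v *m a^T) 0 0.

(* The components of a vector field and of a 1-form in a chart c, as functions
   on the image of c *)
Definition vfield_rep (c : chart R n M) (X : M -> 'rV[R]_n) :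
    'rV[R]_n -> 'rV[R]_n :=
  rep c (fun x => X x *m transition (chart_at x) c x).

Definition form_rep (c : chart R n M) (a : M -> 'rV[R]_n) :
    'rV[R]_n -> 'rV[R]_n :=
  rep c (fun x => a x *m (transition c (chart_at x) x)^T).

Definition smooth_vfield (O : set M) (X : M -> 'rV[R]_n) : Prop :=
  forall c, atlas c -> smooth_on (c @` (dom c `&` O)) (vfield_rep c X).

Definition smooth_form (O : set M) (a : M -> 'rV[R]_n) : Prop :=
  forall c, atlas c -> smooth_on (c @` (dom c `&` O)) (form_rep c a).

(* [X,Y]^i = X^j d_j Y^i - Y^j d_j X^i *)
Definition lie_bracket (X Y : M -> 'rV[R]_n) (x : M) : 'rV[R]_n :=
  let c := chart_at x in
  'D_(X x) (vfield_rep c Y) (c x) - 'D_(Y x) (vfield_rep c X) (c x).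

(* (L_X b)_i = X^j d_j b_i + b_j d_i X^j *)
Definition lie_derivative (X b : M -> 'rV[R]_n) (x : M) : 'rV[R]_n :=
  let c := chart_at x in
  'D_(X x) (form_rep c b) (c x) +
  \row_i pairing (b x) ('D_(delta_mx 0 i) (vfield_rep c X) (c x)).

Definition ext_d (f : M -> R) (x : M) : 'rV[R]_n :=
  let c := chart_at x in \row_i 'D_(delta_mx 0 i) (rep c f) (c x).

Definition courant_bracket (s t : M -> TTM) (x : M) : TTM :=
  let X := fst \o s in let a := snd \o s in
  let Y := fst \o t in let b := snd \o t in
  (lie_bracket X Y x,
   lie_derivative X b x - lie_derivative Y a x +
   2^-1 *: ext_d (fun y => pairing (a y) (Y y) - pairing (b y) (X y)) x).

Definition pairing_g (u v : TTM) : R :=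
  2^-1 * (pairing v.2 u.1 + pairing u.2 v.1).

Definition smooth_section (O : set M) (s : M -> TTM) : Prop :=
  smooth_vfield O (fst \o s) /\ smooth_form O (snd \o s).

Definition subbundle (r : nat) (L : M -> {vspace TTM}) : Prop :=
  forall x, exists O : set M, exists s : 'I_r -> M -> TTM,
    [/\ open O, O x, forall i, smooth_section O (s i) &
      forall y, O y ->
        basis_of (L y) [seq s i y | i <- enum 'I_r]].

Definition almost_dirac_structure (L : M -> {vspace TTM}) : Prop :=
  subbundle n L /\
  forall x u v, u \in L x -> v \in L x -> pairing_g u v = 0.

Definition dirac_structure (L : M -> {vspace TTM}) : Prop :=
  almost_dirac_structure L /\
  forall s t, smooth_section setT s -> smooth_section setT t ->
    (forall x, s x \in L x) -> (forall x, t x \in L x) ->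
    forall x, courant_bracket s t x \in L x.

Definition L_plus (L : M -> {vspace TTM}) (x : M) : set 'rV[R]_n :=
  [set X | exists a, (X, a) \in L x].

Definition direct_sum (A B : set 'rV[R]_n) : Prop :=
  (forall v, exists a b, [/\ A a, B b & v = a + b]) /\
  (forall v, A v -> B v -> v = 0).

Definition annihilator (A : set 'rV[R]_n) : set 'rV[R]_n :=
  [set a | forall v, A v -> pairing a v = 0].

Definition H_space (L : M -> {vspace TTM}) (F : foliation M) (x : M) :
    set 'rV[R]_n :=
  [set Z | exists2 a, annihilator (fol_tangent F x) a & (Z, a) \in L x].

Definition coupling (L : M -> {vspace TTM}) (F : foliation M) : Prop :=
  forall x, direct_sum (H_space L F x) (fol_tangent F x).

End TensorCalculus.

Section Submanifolds.
Context {R : realType} {k n : nat}.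
Variables (S : manifold R k) (M : manifold R n).

Definition smooth_map (i : S -> M) : Prop :=
  continuous i /\
  forall c d, atlas c -> atlas d ->
    smooth_on (c @` (dom c `&` i @^-1` dom d)) (rep c (d \o i)).

Definition tangent_map (i : S -> M) (s : S) : 'M[R]_(k, n) :=
  'J (rep (chart_at s) (chart_at (i s) \o i)) (chart_at s s).

Definition immersed_submanifold (i : S -> M) : Prop :=
  [/\ smooth_map i, injective i & forall s, row_free (tangent_map i s)].

Definition submanifold_tangent (i : S -> M) (s : S) : set 'rV[R]_n :=
  range (fun v : 'rV[R]_k => v *m tangent_map i s).

(* Leaves are integral submanifolds, in general only injectively immersed;
   neither connectedness nor maximality is required. *)
Definition presymplectic_leaf (L : M -> {vspace ('rV[R]_n * 'rV[R]_n)})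
    (i : S -> M) : Prop :=
  immersed_submanifold i /\
  forall s, submanifold_tangent i s = L_plus L (i s).

End Submanifolds.

(* L|_U; see [open_submanifold] for the identification of T_xU with T_xM. *)
Definition restrict_structure (R : realType) (n : nat) (M : manifold R n)
    (U : set M) (oU : open U) (L : M -> {vspace ('rV[R]_n * 'rV[R]_n)}) :
    open_submanifold oU -> {vspace ('rV[R]_n * 'rV[R]_n)} :=
  fun x => L (set_val x).
Arguments restrict_structure {R n M U} oU L x.

(* Main.v *)
From HB Require Import structures.
Require Import Defs.
From mathcomp Require Import all_boot all_order all_algebra.
From mathcomp Require Import all_classical all_reals all_analysis.
Import Order.TTheory GRing.Theory Num.Theory.
Import numFieldNormedType.Exports.

(** Let E = F (+) ann F, a subbundle of TM (+) T*M of rank n.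

    The coupling condition at a point x follows from L_x and E_x meeting
    trivially. Since both have rank n, they then span T_xM (+) T*_xM, and the
    decomposition (v, 0) = (Z, a) + (v - Z, - a) along L_x (+) E_x has a in
    ann F_x, so that Z is in H_x and v - Z is in F_x. And if Z lies in both
    H_x and F_x, some (Z, a) lies in L_x and in E_x, so Z = 0.

    At a point of the leaf S, L_x and E_x do meet trivially
    ([isotropic_cap_conormal]): if (X, a) is in both, then X is in TS, the
    projection of L_x, and in F_x, so X = 0; then isotropy makes a vanish on
    TS, and a vanishes on F_x as well, hence on T_xM.

    Finally, meeting trivially is an open condition ([near_direct_sum]). In a
    foliated chart c, E is the kernel of a linear map from TM (+) T*M to R^n,
    [conormal_defect], made of the transverse components of the vector and the
    leafwise components of the covector. Its values on a local frame of L are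
    the rows of an n x n matrix, invertible exactly where L and E meet
    trivially, and whose determinant is continuous
    ([conormal_defect_continuous_at]). So U can be taken to be the interior of
    the set of the points where the coupling condition holds.

    Tangent vectors at x are represented in the preferred chart at x, which
    varies with x without any continuity. Hence continuity is always
    established for components in a fixed chart, and the cocycle rule for
    transition matrices ([transition_mul]) relates these to the representation
    at each point. That the tangent spaces of F can be computed in any foliated
    chart is [fol_tangentE]. *)

Set Implicit Arguments.
Unset Strict Implicit.
Unset Printing Implicit Defensive.

Local Open Scope classical_set_scope.
Local Open Scope ring_scope.

(** * Jacobian matrices *)

Section Jacobian.
Context {R : realType}.

Lemma mulmx_inj_row (K : pzRingType) m p (A B : 'M[K]_(m, p)) :
  (forall v : 'rV_m, v *m A = v *m B) -> A = B.
Proof. by move=> AB; apply/row_matrixP => i; rewrite !rowE. Qed.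

Lemma mulmx_jacobian m p (f : 'rV[R]_m -> 'rV[R]_p) z (v : 'rV[R]_m) :
  differentiable f z -> v *m 'J f z = 'D_v f z.
Proof. by move=> df; rewrite mul_rV_lin1; symmetry; exact: (deriveE v df). Qed.

Lemma near_eq_jacobian m p (f g : 'rV[R]_m -> 'rV[R]_p) z :
  {near z, f =1 g} -> differentiable f z -> 'J f z = 'J g z.
Proof.
move=> fg df; have dg := near_eq_differentiable fg df.
apply: mulmx_inj_row => v.
apply: eq_trans (mulmx_jacobian v df) (eq_trans _ (esym (mulmx_jacobian v dg))).
exact: near_eq_derive.
Qed.

Lemma jacobian_comp m p q (f : 'rV[R]_m -> 'rV[R]_p) (g : 'rV[R]_p -> 'rV[R]_q)
    z :
  differentiable f z -> differentiable g (f z) ->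
  'J (g \o f) z = 'J f z *m 'J g (f z).
Proof.
move=> df dg; have dgf := differentiable_comp df dg.
apply: mulmx_inj_row => v.
apply: eq_trans (mulmx_jacobian v dgf) _.
rewrite mulmxA (mulmx_jacobian v df) (mulmx_jacobian _ dg).
rewrite (deriveE v dgf) (deriveE v df) (deriveE _ dg).
by rewrite (diff_comp df dg).
Qed.

End Jacobian.

(** * Continuity of matrix-valued functions *)

Section EntrywiseContinuity.
Context {R : realType} {T : topologicalType} (x : T).

(** Entrywise, because determinants and products are polynomials in the
    entries, and the entries of a Jacobian are partial derivatives. *)
Definition mx_continuous_at m p (f : T -> 'M[R]_(m, p)) : Prop :=
  forall i j, {for x, continuous (fun y => f y i j)}.

Lemma mx_continuous_at_cst m p (A : 'M[R]_(m, p)) :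
  mx_continuous_at (fun=> A).
Proof. by move=> i j; apply: cst_continuous. Qed.

Lemma mx_continuous_at_add m p (f g : T -> 'M[R]_(m, p)) :
  mx_continuous_at f -> mx_continuous_at g ->
  mx_continuous_at (fun y => f y + g y).
Proof.
move=> cf cg i j; rewrite /prop_for /continuous_at mxE.
under eq_fun do rewrite mxE.
by apply: cvgD; [apply: cf|apply: cg].
Qed.

Lemma mx_continuous_at_tr m p (f : T -> 'M[R]_(m, p)) :
  mx_continuous_at f -> mx_continuous_at (fun y => (f y)^T).
Proof.
move=> cf i j; rewrite /prop_for /continuous_at mxE.
by under eq_fun do rewrite mxE; apply: cf.
Qed.

Lemma mx_continuous_at_mul m p q (f : T -> 'M[R]_(m, p))
    (g : T -> 'M[R]_(p, q)) :
  mx_continuous_at f -> mx_continuous_at g ->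
  mx_continuous_at (fun y => f y *m g y).
Proof.
move=> cf cg i j; rewrite /prop_for /continuous_at mxE.
under eq_fun do rewrite mxE.
apply: cvg_big => [|l _]; first exact: add_continuous.
by apply: cvgM; [apply: cf|apply: cg].
Qed.

Lemma det_continuous_at m (f : T -> 'M[R]_m) :
  mx_continuous_at f -> {for x, continuous (fun y => \det (f y))}.
Proof.
move=> cf; apply: cvg_big => [|s _]; first exact: add_continuous.
apply: cvgM; first exact: cvg_cst.
by apply: cvg_big => [|l _]; [exact: mul_continuous|apply: cf].
Qed.

End EntrywiseContinuity.

(** * A linear map on a subspace of known basis *)

Section LinearAlgebra.
Context {K : fieldType} {V : vectType K} {n : nat}.
Variables (f : {linear V -> 'rV[K]_n}) (U : {vspace V}) (b : 'I_n -> V).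
Hypothesis Ub : basis_of U [seq b i | i <- enum 'I_n].

Let G := \matrix_i f (b i).

Let comb (l : 'rV[K]_n) := \sum_i l 0 i *: b i.

Let combU l : comb l \in U.
Proof.
apply: rpred_sum => i _; apply/rpredZ/(basis_mem Ub)/map_f.
by rewrite mem_enum.
Qed.

Let f_comb l : f (comb l) = l *m G.
Proof.
rewrite linear_sum mulmx_sum_row; apply: eq_bigr => i _.
by rewrite linearZ rowK.
Qed.

Let bE : tval [tuple b i | i < n] = [seq b i | i <- enum 'I_n].
Proof. by []. Qed.

Let U_comb u : u \in U -> exists l, u = comb l.
Proof.
move=> uU; have Xb := Ub; rewrite -bE in Xb.
exists (\row_i coord [tuple b i | i < n] i u).
rewrite {1}(coord_basis Xb uU); apply: eq_bigr => i _.
by rewrite mxE -tnth_nth tnth_mktuple.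
Qed.

Let comb0 l : comb l = 0 -> l = 0.
Proof.
move=> l0; have Xb := Ub; rewrite -bE in Xb.
have /freeP/(_ (fun i => l 0 i)) := basis_free Xb.
move=> h; apply/rowP => i; rewrite mxE; apply: h.
by rewrite -[RHS]l0; apply: eq_bigr => j _; rewrite -tnth_nth tnth_mktuple.
Qed.

(** For n = dim U, this turns the triviality of the intersection of U with the
    kernel of f into the non-vanishing of a determinant. *)
Lemma basis_image_unitmxP :
  reflect (forall u, u \in U -> f u = 0 -> u = 0) (G \in unitmx).
Proof.
rewrite -row_free_unit -kermx_eq0; apply: (iffP eqP) => [kG u uU fu|h].
  have [l lE] := U_comb uU; rewrite lE f_comb in fu.
  have /sub_kermxP : l *m G = 0 := fu.
  rewrite kG submx0 => /eqP l0; rewrite lE l0 /comb.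
  by apply: big1 => i _; rewrite mxE scale0r.
apply/row_matrixP => i; rewrite row0; apply/comb0/h => //.
by rewrite f_comb; apply/sub_kermxP/row_sub.
Qed.

Lemma basis_image_onto w : G \in unitmx -> exists2 u, u \in U & f u = w.
Proof.
by move=> uG; exists (comb (w *m invmx G)); rewrite ?f_comb ?mulmxKV.
Qed.

End LinearAlgebra.

(** * Transition matrices between charts *)

Section Transitions.
Context {R : realType} {n : nat} {M : topologicalType}.
Implicit Types (c d e : chart R n M) (x : M).

(** Charts are open maps, so that what holds near x is seen on a full
    neighborhood of c x; this transports local identities to R^n. *)
Lemma near_chart c x (P : set M) : is_chart c -> dom c x -> nbhs x P ->
  \forall z \near c x, exists y, [/\ dom c y, P y & c y = z].
Proof.
move=> hc cx xP.
have oW : open (P° `&` dom c).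
  exact: openI (open_interior _) (chart_dom_open hc).
apply: filterS (open_nbhs_nbhs (conj (chart_open_map hc oW (@subIsetr _ _ _)) _)).
  by move=> _ [y [/interior_subset Py cy] <-]; exists y.
by exists x.
Qed.

Lemma near_eq_continuous_at (V : topologicalType) (f g : M -> V) x :
  {near x, f =1 g} -> {for x, continuous f} -> {for x, continuous g}.
Proof.
move=> fg cf; rewrite /prop_for /continuous_at -(nbhs_singleton fg).
exact: cvg_trans (near_eq_cvg fg) cf.
Qed.

Lemma near_rep_comp (V : normedModType R) c d (f : M -> V) x :
  is_chart c -> is_chart d -> dom c x -> dom d x ->
  {near c x, rep d f \o rep c d =1 rep c f}.
Proof.
move=> hc hd cx dx.
apply: filterS (near_chart hc cx (open_nbhs_nbhs (conj (chart_dom_open hd) dx))).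
by move=> _ [y [cy dy <-]]; rewrite /= !repE.
Qed.

Lemma rep_comp_differentiable c d e x :
  is_chart c -> is_chart d -> dom c x -> dom d x ->
  differentiable (rep c d) (c x) -> differentiable (rep d e) (d x) ->
  differentiable (rep c e) (c x).
Proof.
move=> hc hd cx dx dcd dde.
apply: near_eq_differentiable (near_rep_comp e hc hd cx dx) _.
by apply: differentiable_comp dcd _; rewrite repE.
Qed.

(** The cocycle rule is the chain rule for the composite of two chart changes,
    which agrees near c x with the direct one. *)
Lemma transition_mul c d e x :
  is_chart c -> is_chart d -> dom c x -> dom d x ->
  differentiable (rep c d) (c x) -> differentiable (rep d e) (d x) ->
  transition c d x *m transition d e x = transition c e x.
Proof.
move=> hc hd cx dx dcd dde.
have cdx : rep c d (c x) = d x by apply: repE.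
have dde' : differentiable (rep d e) (rep c d (c x)) by rewrite cdx.
have := near_eq_jacobian (near_rep_comp e hc hd cx dx)
  (differentiable_comp dcd dde').
by rewrite (jacobian_comp dcd dde') {1}cdx.
Qed.

Lemma transition_id c x : is_chart c -> dom c x -> transition c c x = 1%:M.
Proof.
move=> hc cx.
have cc : {near c x, id =1 rep c c}.
  apply: filterS (near_chart hc cx (@filterT _ (nbhs x) _)).
  by move=> _ [y [cy _ <-]]; rewrite repE.
have did : differentiable (id : 'rV[R]_n -> 'rV[R]_n) (c x).
  by apply: ex_diff.
apply: eq_trans (esym (near_eq_jacobian cc did)) _.
apply: mulmx_inj_row => v; apply: eq_trans (mulmx_jacobian v did) _.
by rewrite mulmx1 (deriveE v did) diff_val.
Qed.

Lemma compatible_differentiable c d x : compatible c d ->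
  dom c x -> dom d x ->
  differentiable (rep c d) (c x) /\ differentiable (rep d c) (d x).
Proof.
move=> [cd dc] cx dx; have [+ _] := cd 1; have [+ _] := dc 1.
by move=> h1 h2; split; [apply: h2|apply: h1]; exists x.
Qed.

Lemma transition_continuous_at c d x : is_chart c ->
  smooth_on (c @` (dom c `&` dom d)) (rep c d) -> open (dom d) ->
  dom c x -> dom d x ->
  mx_continuous_at x (transition c d).
Proof.
move=> hc sm od cx dx i j.
have [df /(_ i) cD] := sm 1.
have nx : \forall y \near x, dom c y /\ dom d y.
  exact: (open_nbhs_nbhs (conj (openI (chart_dom_open hc) od) (conj cx dx))).
have E y : dom c y -> dom d y ->
    transition c d y i j = 'D_(delta_mx 0 i) (rep c d) (c y) 0 j.
  move=> cy dy; have dfy : differentiable (rep c d) (c y).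
    by apply: df; exists y.
  by rewrite -(mulmx_jacobian _ dfy) -rowE [RHS]mxE.
have nE : {near x, (fun y => 'D_(delta_mx 0 i) (rep c d) (c y) 0 j) =1
                   (fun y => transition c d y i j)}.
  by apply: filterS nx => y [cy dy]; rewrite E.
apply: near_eq_continuous_at nE _.
apply: (@continuous_comp _ _ _ (fun y => 'D_(delta_mx 0 i) (rep c d) (c y))
  (fun w : 'rV[R]_n => w 0 j)); last exact: coord_continuous.
apply: (@continuous_comp _ _ _ c ('D_(delta_mx 0 i) (rep c d))).
  exact: (chart_continuous hc).
have zx : (c @` (dom c `&` dom d)) (c x) by exists x.
exact: cD zx.
Qed.

End Transitions.

Section RestrictTransition.
Context {R : realType} {n : nat} {M : topologicalType}.
Variables (U : set M) (oU : open U).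

(** A restricted chart has the same local expression near each of its points,
    so that its derivative is unchanged, although the two expressions may
    differ away from them. *)
Lemma restrict_transition (c d : chart R n M) (x : U) : is_chart c ->
  dom c (set_val x) -> differentiable (rep c d) (c (set_val x)) ->
  transition (restrict_chart U c) (restrict_chart U d) x =
  transition c d (set_val x).
Proof.
move=> hc cx dcd; have hU := restrict_is_chart oU hc.
symmetry; apply: near_eq_jacobian dcd.
apply: filterS (near_chart hU (x := x) cx (@filterT _ (nbhs x) _)).
move=> z [y [cy _ <-]]; rewrite (repE _ hU cy).
exact: (repE d hc cy).
Qed.

End RestrictTransition.

(** * Equations for a subspace and its annihilator *)

Section ConormalKernel.
Context {R : realType} {n : nat}.

Lemma mul_pid_mxE (K : pzRingType) r (w : 'rV[K]_n) j :
  (w *m pid_mx r : 'rV_n) 0 j = w 0 j *+ (j < r)%N.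
Proof.
rewrite mxE (bigD1 j) //= mxE eqxx /= mulr_natr big1 ?addr0 // => l lj.
by rewrite mxE [_ == _ :> nat](negbTE lj) mulr0.
Qed.

Lemma same_transverse_copid r (w : 'rV[R]_n) :
  same_transverse r w 0 <-> w *m copid_mx r = 0.
Proof.
have E j : (w *m copid_mx r) 0 j = w 0 j - w 0 j *+ (j < r)%N.
  by rewrite mulmxBr mulmx1 mxE [in X in _ + X]mxE mul_pid_mxE.
split=> [w0|/rowP h j rj].
  apply/rowP => j; rewrite E mxE; case: ltnP => [_|rj]; first by rewrite subrr.
  by rewrite subr0 (w0 j rj) mxE.
by have := h j; rewrite E ltnNge rj subr0.
Qed.

(** Here A is the change from the ambient components of vectors to adapted ones,
    in which the subspace is that of the first r basis vectors; covectors
    transform by the transposed inverse of A. The two summands have their only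
    nonzero entries in complementary columns, so their sum vanishes iff both
    do. *)
Lemma conormal_kernel r (A B : 'M[R]_n) v a : (r <= n)%N -> B *m A = 1%:M ->
  v *m A *m copid_mx r + a *m B^T *m pid_mx r = 0 :> 'rV[R]_n <->
  same_transverse r (v *m A) 0 /\
  annihilator [set w | same_transverse r (w *m A) 0] a.
Proof.
move=> le_rn BA; have AB := mulmx1C BA.
have annE : annihilator [set w | same_transverse r (w *m A) 0] a <->
    a *m B^T *m pid_mx r = 0 :> 'rV[R]_n.
  split=> [ann|a0 w /= /same_transverse_copid wA].
    apply: trmx_inj; rewrite trmx0 !trmx_mul trmxK tr_pid_mx.
    apply: mulmx_inj_row => w; rewrite mulmx0.
    have /ann : same_transverse r (w *m pid_mx r *m B *m A) 0.
      apply/same_transverse_copid.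
      by rewrite -(mulmxA _ B) BA mulmx1 -mulmxA mul_pid_mx_copid ?mulmx0.
    rewrite /pairing !mulmxA => h; apply/matrixP => i k.
    by rewrite !ord1 h mxE.
  rewrite /pairing -[w]mulmx1 -AB mulmxA.
  have -> : w *m A = w *m A *m pid_mx r.
    by move/eqP: wA; rewrite mulmxBr mulmx1 subr_eq0 => /eqP.
  move: a0 => /(congr1 trmx); rewrite trmx0 !trmx_mul trmxK tr_pid_mx => a0.
  by rewrite -!mulmxA a0 !mulmx0 mxE.
rewrite same_transverse_copid annE.
split=> [h|[h1 h2]]; last by rewrite h1 h2 addr0.
split.
  (* The complementary projections separate the two summands. *)
  have := congr1 (mulmx^~ (copid_mx r)) h.
  rewrite mul0mx mulmxDl -!(mulmxA _ (copid_mx r)).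
  by rewrite -(mulmxA _ (pid_mx r)) copid_mx_id // mul_pid_mx_copid // mulmx0 addr0.
have := congr1 (fun w => w *m (pid_mx r : 'M[R]_n)) h.
rewrite /= mul0mx mulmxDl -!(mulmxA _ (copid_mx r)).
by rewrite -(mulmxA _ (pid_mx r)) mul_copid_mx_pid // pid_mx_id // mulmx0 add0r.
Qed.

End ConormalKernel.

(** * The tangent bundle of a foliation in foliated charts *)

Section FoliatedCharts.
Context {R : realType} {n : nat} {M : manifold R n}.
Variable F : foliation M.
Local Notation p := (leaf_dim F).
Implicit Types (c d : chart R n M) (x : M).

(** Foliated charts are only assumed compatible with the charts of the manifold,
    hence the detour through one of these. *)
Lemma fol_chart_differentiable c d x :
  fol_atlas F c -> fol_atlas F d -> dom c x -> dom d x ->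
  differentiable (rep c d) (c x).
Proof.
move=> hc hd cx dx.
have ha := atlas_chart_at x; have ax := dom_chart_at x.
have [ca _] := compatible_differentiable (fol_atlas_compatible hc ha) cx ax.
have [_ ad] := compatible_differentiable (fol_atlas_compatible hd ha) dx ax.
exact: rep_comp_differentiable (fol_atlas_chart hc) (atlas_chart ha) cx ax ca ad.
Qed.

(** Along the line in direction v through c x, the point stays in the plaque of
    x, so the transverse coordinates of the other chart are constant, and their
    derivative in direction v vanishes. *)
Lemma transition_plaque c d x v :
  fol_atlas F c -> fol_atlas F d -> dom c x -> dom d x ->
  same_transverse p v 0 -> same_transverse p (v *m transition c d x) 0.
Proof.
move=> hc hd cx dx v0 j pj.
have dcd := fol_chart_differentiable hc hd cx dx.
have hcc := fol_atlas_chart hc; have hdc := fol_atlas_chart hd.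
have [W [oW Wx Wcd Wp]] := fol_atlas_plaques hc hd cx dx.
have -> : v *m transition c d x = 'D_v (rep c d) (c x) := mulmx_jacobian v dcd.
rewrite [RHS]mxE.
have /cvg_ex[l dl] := diff_derivable (v := v) dcd.
rewrite /derive (cvg_lim _ dl) //.
(* q is the difference quotient of the transverse coordinate j. *)
pose q (h : R) : R :=
  (h^-1 *: ((rep c d \o shift (c x)) (h *: v) - rep c d (c x))) 0 j.
have ql : q @ 0^' --> l 0 j.
  have lc : {for l, continuous (fun w : 'rV[R]_n => w 0 j)}.
    exact: coord_continuous.
  exact: continuous_cvg lc dl.
suff q0 : q @ 0^' --> (0 : R) by exact: norm_cvg_unique ql q0.
suff nq : \forall h \near 0^', cst (0 : R) h = q h.
  exact: cvg_trans (near_eq_cvg nq) (cvg_cst 0).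
have vW : \forall h \near (0 : R), exists y,
    [/\ dom c y, W y & c y = h *: v + c x].
  have cv : (fun h : R => h *: v + c x) @ (0 : R) --> c x.
    rewrite -[X in _ --> X]add0r -[X in X + _](scale0r v).
    by apply: cvgD; [apply: cvgZr_tmp; exact: cvg_id|exact: cvg_cst].
  exact: cv (near_chart hcc cx (open_nbhs_nbhs (conj oW Wx))).
apply: nbhs_dnbhs; apply: filterS vW => h [y [cy Wy cyE]].
have [_ dy] := Wcd y Wy.
have -> : q h = h^-1 * ((rep c d (c y)) 0 j - (rep c d (c x)) 0 j).
  by rewrite cyE /q !mxE.
rewrite (repE d hcc cy) (repE d hcc cx) (Wp y x Wy Wx _ j pj) ?subrr ?mulr0 // => i pi.
by rewrite cyE !mxE (v0 i pi) mxE mulr0 add0r.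
Qed.

Lemma fol_tangentE c x v : fol_atlas F c -> dom c x ->
  fol_tangent F x v <->
  same_transverse p (v *m transition (chart_at x) c x) 0.
Proof.
move=> hc cx; split=> [[d [hd dx vd]]|]; last by exists c.
have ha := atlas_chart_at x; have ax := dom_chart_at x.
have [_ ad] := compatible_differentiable (fol_atlas_compatible hd ha) dx ax.
rewrite -(transition_mul (atlas_chart ha) (fol_atlas_chart hd) ax dx ad
  (fol_chart_differentiable hd hc dx cx)) mulmxA.
exact: transition_plaque.
Qed.

Lemma transitionK c x : fol_atlas F c -> dom c x ->
  transition c (chart_at x) x *m transition (chart_at x) c x = 1%:M.
Proof.
move=> hc cx; have ha := atlas_chart_at x; have ax := dom_chart_at x.
have [ca ac] := compatible_differentiable (fol_atlas_compatible hc ha) cx ax.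
have hcc := fol_atlas_chart hc.
by rewrite (transition_mul hcc (atlas_chart ha) cx ax ca ac) transition_id.
Qed.

(** The transverse components of the vector and the leafwise components of the
    covector, in the foliated chart c, side by side in one row: the projections
    [copid_mx] and [pid_mx] keep complementary sets of columns. Its kernel is
    F (+) ann F. *)
Definition conormal_defect c x (u : 'rV[R]_n * 'rV[R]_n) : 'rV[R]_n :=
  u.1 *m transition (chart_at x) c x *m copid_mx p +
  u.2 *m (transition c (chart_at x) x)^T *m pid_mx p.

Fact conormal_defect_is_linear c x : linear (conormal_defect c x).
Proof.
move=> k u v; rewrite /conormal_defect /= !mulmxDl -!scalemxAl scalerDr.
by rewrite addrACA.
Qed.

HB.instance Definition _ c x := GRing.isLinear.Build _ _ _ _
  (conormal_defect c x) (conormal_defect_is_linear c x).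

Lemma conormal_defect_eq0 c x u : fol_atlas F c -> dom c x ->
  conormal_defect c x u = 0 <->
  fol_tangent F x u.1 /\ annihilator (fol_tangent F x) u.2.
Proof.
move=> hc cx.
have -> : fol_tangent F x =
    [set v | same_transverse p (v *m transition (chart_at x) c x) 0].
  by apply/seteqP; split=> v /(fol_tangentE _ hc cx).
exact: conormal_kernel (leaf_dim_le F) (transitionK hc cx).
Qed.

End FoliatedCharts.

(** * The coupling condition near a point *)

Section Coupling.
Context {R : realType} {n : nat} {M : manifold R n}.
Variables (F : foliation M) (L : M -> {vspace ('rV[R]_n * 'rV[R]_n)}).
Implicit Types (c : chart R n M) (x : M).

(** An invertible matrix means that the kernel F (+) ann F is a complement of
    L_x, along which the vectors (v, 0) can be decomposed. *)
Lemma unitmx_direct_sum c x (b : 'I_n -> 'rV[R]_n * 'rV[R]_n) :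
  fol_atlas F c -> dom c x -> basis_of (L x) [seq b i | i <- enum 'I_n] ->
  (\matrix_i conormal_defect F c x (b i)) \in unitmx ->
  direct_sum (H_space L F x) (fol_tangent F x).
Proof.
move=> hc cx Lb uG; split=> [v|v [a ann va] vF]; last first.
  have inj := elimT (basis_image_unitmxP (conormal_defect F c x) Lb) uG.
  have h := inj _ va.
  suff /h [-> _] : conormal_defect F c x (v, a) = 0 by [].
  exact/(conormal_defect_eq0 _ hc cx).
have [[Z a] ZL Za] := basis_image_onto (f := conormal_defect F c x) Lb
  (conormal_defect F c x (v, 0)) uG.
have /(conormal_defect_eq0 _ hc cx)[/= vF aF] :
    conormal_defect F c x ((v, 0) - (Z, a)) = 0 by rewrite linearB /= Za subrr.
exists Z, (v - Z); split=> //; last by rewrite addrC subrK.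
exists a => // w /aF; rewrite sub0r /pairing linearN mulmxN mxE.
by move/eqP; rewrite oppr_eq0 => /eqP.
Qed.

(** X is in L_+ and in F, hence zero; then pairing (0, a) with L_x shows that a
    vanishes on L_+, and it vanishes on F, hence on L_+ + F = T_xM. *)
Lemma isotropic_cap_conormal x :
  (forall u v, u \in L x -> v \in L x -> pairing_g u v = 0) ->
  direct_sum (L_plus L x) (fol_tangent F x) ->
  forall u, u \in L x -> fol_tangent F x u.1 ->
    annihilator (fol_tangent F x) u.2 -> u = 0.
Proof.
move=> iso [spanT capT] [X a] /= uL XF aF.
have X0 : X = 0 by apply: capT => //; exists a.
rewrite X0 in uL *; suff -> : a = 0 by [].
apply: trmx_inj; apply: mulmx_inj_row => v; rewrite trmx0 mulmx0.
apply/rowP => j; rewrite ord1 [RHS]mxE.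
have [w [f [[b wL] fF ->]]] := spanT v.
rewrite mulmxDl mxE (aF f fF : (f *m a^T) 0 0 = 0) addr0.
have /eqP := iso _ _ uL wL.
rewrite /pairing_g /pairing /= mul0mx mxE add0r mulf_eq0 invr_eq0 pnatr_eq0.
by move=> /eqP.
Qed.

Lemma chart_mx_continuous_at c x (f : 'rV[R]_n -> 'rV[R]_n) :
  is_chart c -> dom c x -> {for c x, continuous f} ->
  mx_continuous_at x (f \o c).
Proof.
move=> hc cx cf i j; rewrite ord1.
apply: (@continuous_comp _ _ _ (f \o c) (fun w : 'rV[R]_n => w 0 j)).
  by apply: (@continuous_comp _ _ _ c f) => //; exact: (chart_continuous hc).
exact: coord_continuous.
Qed.

(** The preferred chart at y drops out: by the cocycle rule, the defect of s y
    only involves the components of s in the fixed chart d, which are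
    continuous, and the transition matrices between c and d. *)
Lemma conormal_defect_continuous_at c x (O : set M) s :
  fol_atlas F c -> dom c x -> open O -> O x -> smooth_section O s ->
  mx_continuous_at x (fun y => conormal_defect F c y (s y)).
Proof.
move=> hc cx oO Ox [smX sma].
pose d := chart_at x; have hd : atlas d := atlas_chart_at x.
have dx : dom d x := dom_chart_at x.
have hdc := atlas_chart hd; have hcc := fol_atlas_chart hc.
have [cd dc] := fol_atlas_compatible hc hd.
have [odc occ] := (chart_dom_open hdc, chart_dom_open hcc).
pose g y := vfield_rep d (fst \o s) (d y) *m transition d c y *m
    copid_mx (leaf_dim F) +
  form_rep d (snd \o s) (d y) *m (transition c d y)^T *m pid_mx (leaf_dim F).
have nxx : \forall y \near x, dom d y /\ dom c y.
  exact: (open_nbhs_nbhs (conj (openI odc occ) (conj dx cx))).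
have nE : {near x, g =1 (fun y => conormal_defect F c y (s y))}.
  apply: filterS nxx => y [dy cy].
  have hy := atlas_chart_at y; have yy := dom_chart_at y.
  have hyc := atlas_chart hy.
  have [dyd ddy] := compatible_differentiable (atlas_compatible hy hd) yy dy.
  have [dcy dyc] := compatible_differentiable (fol_atlas_compatible hc hy) cy yy.
  have [dcd ddc] := compatible_differentiable (fol_atlas_compatible hc hd) cy dy.
  have Xc : vfield_rep d (fst \o s) (d y) *m transition d c y =
      (s y).1 *m transition (chart_at y) c y.
    rewrite /vfield_rep (repE _ hdc dy) -mulmxA.
    have T := transition_mul hyc hdc yy dy dyd ddc.
    exact: (congr1 (mulmx (s y).1) T).
  have ac : form_rep d (snd \o s) (d y) *m (transition c d y)^T =
      (s y).2 *m (transition c (chart_at y) y)^T.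
    rewrite /form_rep (repE _ hdc dy) -mulmxA -trmx_mul.
    exact: (congr1 (fun A => (s y).2 *m A^T) (transition_mul hcc hdc cy dy dcd ddy)).
  exact: (congr2 (fun X a : 'rV[R]_n =>
    X *m copid_mx (leaf_dim F) + a *m pid_mx (leaf_dim F)) Xc ac).
have dxO : (d @` (dom d `&` O)) (d x) by exists x.
have cX : mx_continuous_at x (vfield_rep d (fst \o s) \o d).
  exact: (chart_mx_continuous_at hdc dx (smX d hd 0 _ dxO)).
have ca : mx_continuous_at x (form_rep d (snd \o s) \o d).
  exact: (chart_mx_continuous_at hdc dx (sma d hd 0 _ dxO)).
have cdc : mx_continuous_at x (transition d c).
  by apply: (transition_continuous_at hdc _ occ dx cx); rewrite setIC.
have ccd : mx_continuous_at x (transition c d).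
  exact: (transition_continuous_at hcc cd odc cx dx).
have cP A : mx_continuous_at x (fun=> A : 'M[R]_n).
  exact: mx_continuous_at_cst.
have cg : mx_continuous_at x g.
  exact: (mx_continuous_at_add
    (mx_continuous_at_mul (mx_continuous_at_mul cX cdc) (cP _))
    (mx_continuous_at_mul
      (mx_continuous_at_mul ca (mx_continuous_at_tr ccd)) (cP _))).
move=> i j; apply: near_eq_continuous_at (cg i j).
by apply: filterS nE => y ->.
Qed.

(** The non-vanishing of the determinant of the defects of a local frame of L
    persists near x. *)
Lemma near_direct_sum x : subbundle n L ->
  (forall u, u \in L x -> fol_tangent F x u.1 ->
    annihilator (fol_tangent F x) u.2 -> u = 0) ->
  \forall y \near x, direct_sum (H_space L F y) (fol_tangent F y).
Proof.
move=> sL L0; have [c hc cx] := fol_atlas_cover F x.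
have [W [s [oW Wx sms Ls]]] := sL x.
pose G y := \matrix_i conormal_defect F c y (s i y).
have cG : mx_continuous_at x G.
  move=> i j; have := conormal_defect_continuous_at hc cx oW Wx (sms i).
  move=> /(_ 0 j); apply: near_eq_continuous_at.
  by apply: nearW => y; rewrite [RHS]mxE.
have dG : \det (G x) != 0.
  rewrite -unitfE -unitmxE.
  have inj u : u \in L x -> conormal_defect F c x u = 0 -> u = 0.
    by move=> uL /(conormal_defect_eq0 _ hc cx)[]; exact: L0.
  have P := basis_image_unitmxP (conormal_defect F c x) (Ls x Wx).
  exact: introT P inj.
have nG : \forall y \near x, \det (G y) != 0.
  exact: cvgr_neq0 (det_continuous_at cG) dG.
have nW := open_nbhs_nbhs (conj oW Wx).
have nc := open_nbhs_nbhs (conj (chart_dom_open (fol_atlas_chart hc)) cx).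
apply: filterS2 (filterI nW nc) nG => y [Wy cy] dGy.
apply: (unitmx_direct_sum hc cy (Ls y Wy)).
by rewrite unitmxE unitfE.
Qed.

End Coupling.

(** * Restriction to an open subset *)

Section Restriction.
Context {R : realType} {n : nat} {M : manifold R n}.
Variables (F : foliation M) (U : set M) (oU : open U).

Lemma restrict_fol_tangent (x : open_submanifold oU) :
  fol_tangent (restrict_foliation oU F) x = fol_tangent F (set_val x).
Proof.
have ha := atlas_chart_at (set_val x); have ax := dom_chart_at (set_val x).
have E c : fol_atlas F c -> dom c (set_val x) ->
    transition (chart_at x) (restrict_chart U c) x =
    transition (chart_at (set_val x)) c (set_val x).
  move=> hc cx.
  have [_ ac] := compatible_differentiable (fol_atlas_compatible hc ha) cx ax.
  exact: (restrict_transition oU (atlas_chart ha) ax ac).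
apply/seteqP; split=> [v [_ [[c hc <-] cx]]|v [c [hc cx vc]]].
  by rewrite E // => vc; exists c.
exists (restrict_chart U c); split; [by exists c|exact: cx|].
exact: (eq_ind_r (fun A => same_transverse (leaf_dim F) (v *m A) 0) vc
  (E c hc cx)).
Qed.

Lemma coupling_restrict (L : M -> {vspace ('rV[R]_n * 'rV[R]_n)}) :
  (forall x, U x -> direct_sum (H_space L F x) (fol_tangent F x)) ->
  coupling (restrict_structure oU L) (restrict_foliation oU F).
Proof.
move=> LU x; rewrite /H_space restrict_fol_tangent.
exact: LU (set_valP x).
Qed.

End Restriction.

(** * Coupling near a presymplectic leaf *)

Theorem proposition3p1 (R : realType) (n : nat) (M : manifold R n)
    (F : foliation M) (L : M -> {vspace ('rV[R]_n * 'rV[R]_n)})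
    (hL : dirac_structure L)
    (k : nat) (S : manifold R k) (i : S -> M)
    (hS : presymplectic_leaf L i)
    (hT : forall s : S,
      direct_sum (submanifold_tangent i s) (fol_tangent F (i s))) :
  exists (U : set M) (oU : open U),
    range i `<=` U /\
    coupling (restrict_structure oU L) (restrict_foliation oU F).
Proof.
have [[sL iso] _] := hL; have [_ leafE] := hS.
exists [set x | direct_sum (H_space L F x) (fol_tangent F x)]°.
exists (@open_interior _ _); split.
  move=> _ [s _ <-]; apply: near_direct_sum sL _.
  by apply: isotropic_cap_conormal (iso _) _; rewrite -leafE; exact: hT.
by apply: coupling_restrict => x /interior_subset.
Qed.
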